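(* Let $(\psi,\{\alpha_a\}_{a\in A_0}):(\mathcal R:A\to \mathsf{RR},X)\to(\mathcal Q:B\to\mathsf{RR},Y)$ be a map of hybrid dynamical systems, and let $(\varphi,\{\sigma_i\}_{i\in Z_0}):(\mathcal T:Z\to\mathsf{RR},\partial_t)\to(\mathcal R:A\to\mathsf{RR},X)$ be an execution of $(\mathcal R:A\to\mathsf{RR},X)$, where $(\mathcal T:Z\to\mathsf{RR},\partial_t)$ is a hybrid time dynamical system. Then the composite $$(\psi,\{\alpha_a\})\circ(\varphi,\{\sigma_i\}):=\bigl(\psi\circ\varphi,\ \{\alpha_{\varphi(i)}\circ\sigma_i\}_{i\in Z_0}\bigr):(\mathcal T:Z\to\mathsf{RR},\partial_t)\to(\mathcal Q:B\to\mathsf{RR},Y)$$ is an execution of $(\mathcal Q:B\to\mathsf{RR},Y)$. In other words, morphisms of hybrid dynamical systems send executions to executions.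
   Context: **Graphs.** A directed multigraph $A=\{A_1\rightrightarrows A_0\}$ consists of collections $A_0$ (nodes) and $A_1$ (arrows), not required to be sets, with source and target maps $\mathfrak s,\mathfrak t:A_1\to A_0$. A map of graphs $\varphi:A\to B$ is a pair of maps $A_0\to B_0$, $A_1\to B_1$ (both written $\varphi$) commuting with source and target. **Regions.** A region is a manifold with corners. A map between manifolds with corners is smooth if it pulls back smooth functions to smooth functions (corners may be mapped to the interior). $Tf$ denotes the differential of $f$. A vector field on $D$ is a section of $TD\to D$. A closed interval $[c,c]$ (a single point) is allowed as a region. **Relations.** A relation from a set $P$ to a set $Q$ is a subset of $Q\times P$ (note the order). **The graph $\mathsf{RR}$.** Its nodes are all manifolds with corners; its arrows from $P$ to $Q$ are all set-theoretic relations $R\subset Q\times P$. **Hybrid phase spaces.** A hybrid phase space is a map of graphs $\mathcal R:A\to\mathsf{RR}$. A map of hybrid phase spaces from $\mathcal R:A\to\mathsf{RR}$ to $\mathcal Q:B\to\mathsf{RR}$ is a pair $(\varphi,\{\alpha_a\}_{a\in A_0})$, where $\varphi:A\to B$ is a map of graphs and each $\alpha_a:\mathcal R(a)\to\mathcal Q(\varphi(a))$ is a smooth map of manifolds with corners, such that for each arrow $a_1\xrightarrow{\gamma}a_2$ of $A$, $$\{(\alpha_{a_2}(y),\alpha_{a_1}(x)) : (y,x)\in\mathcal R(\gamma)\}\subset\mathcal Q(\varphi(\gamma)).$$ **Hybrid dynamical systems.** A hybrid dynamical system is a pair $(\mathcal R:A\to\mathsf{RR},X)$ consisting of a hybrid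 phase space and a family $X=\{X_a\}_{a\in A_0}$ of vector fields, $X_a$ on $\mathcal R(a)$. A map of hybrid dynamical systems $(\mathcal R:A\to\mathsf{RR},X)\to(\mathcal Q:B\to\mathsf{RR},Y)$ is a map of hybrid phase spaces $(\varphi,\{\alpha_a\})$ with $Y_{\varphi(a)}\circ\alpha_a=T\alpha_a\circ X_a$ for all $a\in A_0$. **Hybrid time dynamical systems.** Let $Z$ be a directed graph with countably many nodes which is a directed tree with no branching: for any two distinct nodes $x,y$ there is a unique directed path in $Z$ either from $x$ to $y$ or from $y$ to $x$, but not both. Let $\mathcal T:Z\to\mathsf{RR}$ be a map of graphs such that (1) for each node $i$, $\mathcal T(i)=[t_i^-,t_i^+]$ for some real $t_i^-\le t_i^+$; (2) for each arrow $i\xrightarrow{\gamma}j$, $t_i^+=t_j^-$ and $\mathcal T(\gamma)$ is the one-point relation $\{(t_j^-,t_i^+)\}\subset\mathcal T(j)\times\mathcal T(i)$. Equip each $\mathcal T(i)$ with the constant vector field $\frac{d}{dt}$, and let $\partial_t$ be the resulting family of vector fields. Then $(\mathcal T:Z\to\mathsf{RR},\partial_t)$ is called a hybrid time dynamical system. **Executions.** An execution of $(\mathcal R:A\to\mathsf{RR},X)$ is a map of hybrid dynamical systems $(\varphi,\{\sigma_i\}_{i\in Z_0}):(\mathcal T:Z\to\mathsf{RR},\partial_t)\to(\mathcal R:A\to\mathsf{RR},X)$ from some hybrid time dynamical system. Convention for degenerate intervals: any map from a one-point interval $[c,c]$ to a region is regarded as an integral curve of any vector field on that region. So, in an execution,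 the condition $T\sigma_i\circ\frac{d}{dt}=X_{\varphi(i)}\circ\sigma_i$ is imposed only at nodes $i$ with $t_i^-<t_i^+$. For the map $(\psi,\{\alpha_a\})$ the vector field condition is imposed at every node. *)

(* Defs.v *)
From HB Require Import structures.
From mathcomp Require Import all_boot all_order all_algebra.
From mathcomp Require Import all_classical all_reals all_analysis.
From mathcomp Require Import ring lra.

Set Implicit Arguments.
Unset Strict Implicit.
Unset Printing Implicit Defensive.

Import Order.TTheory GRing.Theory Num.Theory.
Import numFieldNormedType.Exports.

Local Open Scope classical_set_scope.
Local Open Scope ring_scope.

(* C^oo functions on an open subset O of R^n: all iterated directional
   derivatives exist and are continuous at the points of O. The values of g
   outside O are irrelevant. *)
Definition iter_derive (R : realType) n (g : 'rV[R]_n -> R) (vs : seq 'rV[R]_n) :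
  'rV[R]_n -> R := foldl (fun h v => 'D_v h) g vs.

Definition smooth_on (R : realType) n (O : set 'rV[R]_n) (g : 'rV[R]_n -> R) :=
  forall vs x, O x ->
    {for x, continuous (iter_derive g vs)} /\
    forall v, derivable (iter_derive g vs) x v.

Section smooth_on_theory.
Context (R : realType) (n : nat).
Implicit Types (O : set 'rV[R]_n) (g h : 'rV[R]_n -> R).

Lemma smooth_on_sub O O' g : O' `<=` O -> smooth_on O g -> smooth_on O' g.
Proof. by move=> sO sg vs x /sO; exact: sg. Qed.

Lemma smooth_on_derive O g v : smooth_on O g -> smooth_on O ('D_v g).
Proof. by move=> sg vs x Ox; exact: (sg (v :: vs)). Qed.

Let smk k O g := forall vs, (size vs <= k)%N -> forall x, O x ->
    {for x, continuous (iter_derive g vs)} /\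
    forall v, derivable (iter_derive g vs) x v.

Let smk_on O g : (forall k, smk k O g) -> smooth_on O g.
Proof. by move=> sg vs; exact: (sg (size vs) vs (leqnn _)). Qed.

Let on_smk k O g : smooth_on O g -> smk k O g.
Proof. by move=> sg vs _; exact: sg. Qed.

Let smk0 k O g : smk k O g ->
  forall x, O x -> {for x, continuous g} /\ forall v, derivable g x v.
Proof. by move=> sg; exact: (sg [::]). Qed.

Let smkW k O g : smk k.+1 O g -> smk k O g.
Proof. by move=> sg vs /leqW; exact: sg. Qed.

Let smkD k O g v : smk k.+1 O g -> smk k O ('D_v g).
Proof. by move=> sg vs sz; exact: (sg (v :: vs)). Qed.

Let smkS k O g : (forall x, O x -> {for x, continuous g} /\
    forall v, derivable g x v) ->
  (forall v, (0 < k)%N -> smk k.-1 O ('D_v g)) -> smk k O g.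
Proof.
move=> s0 sD [|v vs] sz; first exact: s0.
case: k sD sz => // k sD sz; exact: (sD v).
Qed.

Let near_open O x : open O -> O x -> \near x, O x.
Proof. by move=> oO Ox; exact: open_nbhs_nbhs. Qed.

Let smk_ext k O g h : open O -> (forall x, O x -> g x = h x) ->
  smk k O g -> smk k O h.
Proof.
move=> oO; elim: k g h => [|k IH] g h gh sg; apply: smkS => //.
- move=> x Ox; have [cg dg] := smk0 sg Ox.
  have e : \near x, g x = h x by near=> y; apply: gh; near: y; exact: near_open.
  split; last by move=> v; apply: near_eq_derivable (dg v).
  rewrite /prop_for /continuous_at -(gh _ Ox).
  exact: cvg_trans (near_eq_cvg e) cg.
- move=> x Ox; have [cg dg] := smk0 sg Ox.
  have e : \near x, g x = h x by near=> y; apply: gh; near: y; exact: near_open.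
  split; last by move=> v; apply: near_eq_derivable (dg v).
  rewrite /prop_for /continuous_at -(gh _ Ox).
  exact: cvg_trans (near_eq_cvg e) cg.
- move=> v _ /=; apply: IH (smkD v sg) => x Ox; apply: near_eq_derive.
  by near=> y; apply: gh; near: y; exact: near_open.
Unshelve. all: by end_near. Qed.

Lemma smooth_on_ext O g h : open O -> (forall x, O x -> g x = h x) ->
  smooth_on O g -> smooth_on O h.
Proof. by move=> oO gh sg; apply: smk_on => k; apply: smk_ext gh (on_smk sg). Qed.

Lemma smooth_on_cst O (c : R) : smooth_on O (cst c).
Proof.
move=> vs x _; suff [d ->] : exists d, iter_derive (cst c) vs = cst d.
  split; first exact: (@cst_continuous _ _ d x).
  by move=> v; exact: derivable_cst.
elim: vs c => [|v vs IH] c; first by exists c.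
have [d e] := IH 0; exists d; rewrite -e /iter_derive /=; congr (foldl _ _ _).
by apply/funext => y; rewrite derive_cst.
Qed.

Let smk_lin k O (c : R) g h : open O -> smk k O g -> smk k O h ->
  smk k O (fun x => c * g x + h x).
Proof.
move=> oO; elim: k g h => [|k IH] g h sg sh; apply: smkS => //.
- move=> x Ox; have [cg dg] := smk0 sg Ox; have [ch dh] := smk0 sh Ox.
  split; first exact: (cvgD (cvgM (cvg_cst (c : R^o)) cg) ch).
  by move=> v; apply: (@derivableD _ _ _ (c \*: g) h); [exact: derivableZ|exact: dh].
- move=> x Ox; have [cg dg] := smk0 sg Ox; have [ch dh] := smk0 sh Ox.
  split; first exact: (cvgD (cvgM (cvg_cst (c : R^o)) cg) ch).
  by move=> v; apply: (@derivableD _ _ _ (c \*: g) h); [exact: derivableZ|exact: dh].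
- move=> v _ /=; apply: smk_ext oO _ (IH _ _ (smkD v sg) (smkD v sh)) => x Ox.
  have [_ dg] := smk0 sg Ox; have [_ dh] := smk0 sh Ox.
  have dcg : derivable (c \*: g) x v by exact: derivableZ.
  by have := deriveD dcg (dh v); rewrite (deriveZ c (dg v)) => <-.
Qed.

Lemma smooth_on_lin O (c : R) g h : open O -> smooth_on O g -> smooth_on O h ->
  smooth_on O (fun x => c * g x + h x).
Proof. by move=> oO sg sh; apply: smk_on => k; apply: smk_lin => //; exact: on_smk. Qed.

Let smk_mul k O g h : open O -> smk k O g -> smk k O h ->
  smk k O (fun x => g x * h x).
Proof.
move=> oO; elim: k g h => [|k IH] g h sg sh; apply: smkS => //.
- move=> x Ox; have [cg dg] := smk0 sg Ox; have [ch dh] := smk0 sh Ox.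
  by split; [exact: cvgM cg ch|move=> v; exact: derivableM (dg v) (dh v)].
- move=> x Ox; have [cg dg] := smk0 sg Ox; have [ch dh] := smk0 sh Ox.
  by split; [exact: cvgM cg ch|move=> v; exact: derivableM (dg v) (dh v)].
- move=> v _ /=.
  have := smk_lin 1 oO (IH _ _ (smkW sg) (smkD v sh)) (IH _ _ (smkD v sg) (smkW sh)).
  apply: smk_ext => // x Ox.
  have [_ dg] := smk0 sg Ox; have [_ dh] := smk0 sh Ox.
  by rewrite (deriveM (dg v) (dh v)) mul1r /GRing.scale /= [h x * _]mulrC.
Qed.

Lemma smooth_on_mul O g h : open O -> smooth_on O g -> smooth_on O h ->
  smooth_on O (fun x => g x * h x).
Proof. by move=> oO sg sh; apply: smk_on => k; apply: smk_mul => //; exact: on_smk. Qed.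

End smooth_on_theory.

Lemma smooth_on_coord (R : realType) n (O : set 'rV[R]_n) j :
  smooth_on O (fun x => x 0 j).
Proof.
have D (x v : 'rV[R]_n) : is_derive x v (fun x : 'rV[R]_n => x 0 j : R) (v 0 j).
  have q : (fun h : R => h^-1 *: (((fun x : 'rV[R]_n => x 0 j : R) \o shift x) (h *: v)
    - x 0 j)) @ 0^' --> (v 0 j : R).
    apply/cvg_ballP => e e0; near=> h.
    rewrite /= !mxE addrK /GRing.scale /= mulrA mulVf ?mul1r; first exact: ballxx.
    by near: h; exact: nbhs_dnbhs_neq.
  by apply: DeriveDef; [apply/cvg_ex; exists (v 0 j)|exact/cvg_lim].
move=> [|v vs] x Ox.
  split; first exact: coord_continuous.
  by move=> v; exact: ex_derive.
have e : 'D_v (fun x : 'rV[R]_n => x 0 j) = cst (v 0 j).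
  by apply/funext => y; rewrite derive_val.
by rewrite /iter_derive /= e; exact: smooth_on_cst Ox.
Unshelve. all: by end_near. Qed.

(* The model space [0, oo)^n. *)
Definition corner (R : realType) n : set 'rV[R]_n :=
  [set x | forall i, 0 <= x 0 i].

(* A chart: a homeomorphism from an open subset of M onto a relatively open
   subset of [0, oo)^n. The values of the map outside its domain are
   irrelevant. *)
Record chart (R : realType) (M : topologicalType) := Chart {
  chart_dim : nat;
  chart_dom : set M;
  chart_map :> M -> 'rV[R]_chart_dim;
  chart_dom_open : open chart_dom;
  chart_inj : set_inj chart_dom chart_map;
  chart_continuous : forall p, chart_dom p -> {for p, continuous chart_map};
  chart_open : forall V, open V -> V `<=` chart_dom ->
    exists2 O, open O & chart_map @` V = O `&` @corner R chart_dim }.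

(* f \o c^-1 is smooth on the image c(U): near each point of c(U) it extends
   to a smooth function on an open subset of R^n. *)
Definition smooth_in_chart (R : realType) (M : topologicalType)
    (c : chart R M) (U : set M) (f : M -> R) :=
  forall p, U p -> exists (O : set 'rV[R]_(chart_dim c)) g,
    [/\ open O, O (c p), smooth_on O g &
        forall q, U q -> O (c q) -> f q = g (c q)].

Definition chart_compatible (R : realType) (M : topologicalType)
    (c d : chart R M) :=
  forall j, smooth_in_chart c (chart_dom c `&` chart_dom d) (fun q => d q 0 j).

(* The dimension may vary from one component to another, and the atlas need
   not be maximal: only the smooth functions it determines are used below. *)
Record region (R : realType) := Region {
  region_space :> topologicalType;
  region_hausdorff : hausdorff_space region_space;
  region_second_countable : @second_countable region_space;
  region_atlas : set (chart R region_space);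
  region_cover : forall p, exists2 c, region_atlas c & chart_dom c p;
  region_compatible : forall c d, region_atlas c -> region_atlas d ->
    chart_compatible c d }.

Definition is_smooth_fun (R : realType) (M : region R) (f : M -> R) :=
  forall c, region_atlas c -> smooth_in_chart c (chart_dom c) f.

Record smooth_fun (R : realType) (M : region R) := SmoothFun {
  smooth_fun_val :> M -> R;
  smooth_funP : is_smooth_fun smooth_fun_val }.

Section smooth_fun_algebra.
Context (R : realType) (M : region R).
Implicit Types f g : smooth_fun M.

Lemma smooth_fun_eq f g : f =1 g -> f = g.
Proof.
case: f g => [f sf] [g sg] /= /funext fg.
by move: sf sg; rewrite fg => sf sg; congr SmoothFun; exact: Prop_irrelevance.
Qed.

Lemma is_smooth_fun_lin (a : R) f g : is_smooth_fun (fun p : M => a * f p + g p).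
Proof.
move=> c Ac p cp.
have [U [f' [oU Up sf ef]]] := smooth_funP f Ac cp.
have [P [g' [oP Pp sg eg]]] := smooth_funP g Ac cp.
exists (U `&` P), (fun x => a * f' x + g' x); split => //; first exact: openI.
- apply: smooth_on_lin; first exact: openI.
  + exact: smooth_on_sub sf.
  + exact: smooth_on_sub sg.
- by move=> q cq [Uq Pq]; rewrite ef// eg.
Qed.

Lemma is_smooth_fun_mul f g : is_smooth_fun (fun p : M => f p * g p).
Proof.
move=> c Ac p cp.
have [U [f' [oU Up sf ef]]] := smooth_funP f Ac cp.
have [P [g' [oP Pp sg eg]]] := smooth_funP g Ac cp.
exists (U `&` P), (fun x => f' x * g' x); split => //; first exact: openI.
- apply: smooth_on_mul; first exact: openI.
  + exact: smooth_on_sub sf.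
  + exact: smooth_on_sub sg.
- by move=> q cq [Uq Pq]; rewrite ef// eg.
Qed.

Definition smooth_fun_lin a f g := SmoothFun (is_smooth_fun_lin a f g).
Definition smooth_fun_mul f g := SmoothFun (is_smooth_fun_mul f g).

End smooth_fun_algebra.

Record smooth_map (R : realType) (M N : region R) := SmoothMap {
  smooth_map_val :> M -> N;
  smooth_map_pullback : forall f : smooth_fun N,
    is_smooth_fun (fun p => f (smooth_map_val p)) }.

Definition pullback (R : realType) (M N : region R) (h : smooth_map M N)
  (f : smooth_fun N) : smooth_fun M := SmoothFun (smooth_map_pullback h f).

Definition smooth_map_comp (R : realType) (M N P : region R)
    (k : smooth_map N P) (h : smooth_map M N) : smooth_map M P :=
  @SmoothMap R M P (k \o h) (fun f => smooth_map_pullback h (pullback k f)).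

(* Tangent vectors at p are the derivations at p of C^oo(M). *)
Record tangent (R : realType) (M : region R) (p : M) := Tangent {
  tangent_val :> smooth_fun M -> R;
  tangent_linear : forall a f g,
    tangent_val (smooth_fun_lin a f g) = a * tangent_val f + tangent_val g;
  tangent_leibniz : forall f g,
    tangent_val (smooth_fun_mul f g) = f p * tangent_val g + tangent_val f * g p }.

Section differential.
Context (R : realType) (M N : region R) (h : smooth_map M N) (p : M).

Lemma differential_linear (v : tangent p) a (f g : smooth_fun N) :
  v (pullback h (smooth_fun_lin a f g)) = a * v (pullback h f) + v (pullback h g).
Proof. by rewrite -tangent_linear; congr (v _); exact: smooth_fun_eq. Qed.

Lemma differential_leibniz (v : tangent p) (f g : smooth_fun N) :
  v (pullback h (smooth_fun_mul f g)) =
  f (h p) * v (pullback h g) + v (pullback h f) * g (h p).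
Proof.
rewrite -(tangent_leibniz v (pullback h f) (pullback h g)).
by congr (v _); exact: smooth_fun_eq.
Qed.

Definition differential (v : tangent p) : tangent (h p) :=
  @Tangent R N (h p) (fun f => v (pullback h f))
    (differential_linear v) (differential_leibniz v).

End differential.

(* Smooth sections of the tangent bundle. *)
Record vector_field (R : realType) (M : region R) := VectorField {
  vector_field_val :> forall p : M, tangent p;
  vector_field_smooth : forall f : smooth_fun M,
    is_smooth_fun (fun p => vector_field_val p f) }.

Lemma continuous_const_mx (R : realType) (T : topologicalType) (w : T -> R) n :
  continuous w -> continuous (fun t => const_mx (w t) : 'rV[R]_n).
Proof.
move=> cw t; apply/cvg_ballP => r r0.
have /cvg_ballP/(_ _ r0) := cw t; apply: filterS => u tu.
by split => // i j; rewrite !mxE.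
Qed.

Lemma continuous_affine (R : realType) (T : topologicalType) (v : T -> R)
  (e k : R) : continuous v -> continuous (fun t => e * v t + k).
Proof.
move=> cv t; apply: cvgD; last exact: cvg_cst.
by apply: cvgMl_tmp; exact: cv.
Qed.

(* The interval [a, b] as a manifold with corners. Its charts are s |-> s - a
   on [a, b), s |-> b - s on (a, b], and, with nonempty domain only when a = b,
   the map to R^0. *)
Section interval_region.
Context (R : realType) (a b : R).

Definition itv_space : topologicalType := set_type `[a, b].

Definition itv_val (s : itv_space) : R := sval s.

Lemma itv_val_inj : injective itv_val.
Proof. exact: val_inj. Qed.

Lemma itv_bounds (s : itv_space) : a <= itv_val s <= b.
Proof. by case: s => s; rewrite /itv_val /= => /set_mem /=; rewrite in_itv. Qed.

Definition itv_point (s : R) (sab : a <= s <= b) : itv_space :=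
  exist _ s (mem_set (sab : [set` `[a, b]] s)).

Lemma itv_val_continuous : continuous itv_val.
Proof. exact: initial_continuous. Qed.

Lemma itv_hausdorff : hausdorff_space itv_space.
Proof.
rewrite open_hausdorff => x y xy.
have : itv_val x != itv_val y by apply: contra xy => /eqP /itv_val_inj ->.
have := @Rhausdorff R; rewrite open_hausdorff => /[apply].
move=> [[A B] /= [xA yB] [oA oB AB0]].
exists (itv_val @^-1` A, itv_val @^-1` B) => /=.
  by split; rewrite inE /=; [move: xA|move: yB]; rewrite inE.
split; [by exists A|by exists B|].
by apply/eqP; rewrite -preimage_setI (eqP AB0) preimage_set0.
Qed.

Lemma itv_second_countable : @second_countable itv_space.
Proof.
pose J (x : rat * rat) : set R := [set s | ratr x.1 < s] `&` [set s | s < ratr x.2].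
pose I (x : rat * rat) : set itv_space := itv_val @^-1` J x.
exists (I @` setT); first exact/(sub_countable (card_image_le _ _))/countableP.
split.
  move=> _ [x _ <-]; exists (J x) => //.
  by apply: openI; [exact: open_gt|exact: open_lt].
move=> x V [_ [[W oW <-] Wx WV]].
have /nbhs_ballP[e /= e0 eW] : nbhs (itv_val x : R) W by exact: open_nbhs_nbhs.
have [|p pin] := @rat_in_itvoo R (itv_val x - e) (itv_val x); first by rewrite ltrBlDr ltrDl.
have [|q qin] := @rat_in_itvoo R (itv_val x) (itv_val x + e); first by rewrite ltrDl.
move: pin qin; rewrite !in_itv /= => /andP[p1 p2] /andP[q1 q2].
exists (I (p, q)); first by split; [exists (p, q)|split].
move=> y [/= py yq]; apply: WV => /=; apply: eW.
have l := lt_trans p1 py; have r := lt_trans yq q2.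
rewrite /ball /= ltr_distlC -/(itv_val y); apply/andP; split => //.
Qed.

Section affine_chart.
Context (e k : R).
Hypothesis e2 : e * e = 1.
Hypothesis ekP : forall s, (a <= s <= b) = (0 <= e * s + k <= b - a).

Definition affine_map (s : itv_space) : 'rV[R]_1 := const_mx (e * itv_val s + k).
Definition affine_dom : set itv_space := [set s | e * itv_val s + k < b - a].

Let aff_continuous : continuous (fun s : itv_space => e * itv_val s + k).
Proof. exact: continuous_affine itv_val_continuous. Qed.

Lemma affine_continuous : continuous affine_map.
Proof. exact: continuous_const_mx aff_continuous. Qed.

Lemma affine_dom_open : open affine_dom.
Proof.
apply: (@open_comp _ _ (fun s : itv_space => e * itv_val s + k) [set x | x < b - a]).
  by move=> s _; exact: aff_continuous.
exact: open_lt.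
Qed.

Lemma affine_inj : set_inj affine_dom affine_map.
Proof.
move=> s t _ _ /matrixP /(_ 0 0); rewrite !mxE => /addIr est.
by apply: itv_val_inj; rewrite -[LHS]mul1r -[RHS]mul1r -e2 -!mulrA est.
Qed.

Lemma affine_open V : open V -> V `<=` affine_dom ->
  exists2 O, open O & affine_map @` V = O `&` @corner R 1.
Proof.
move=> [W oW <-] Vdom.
pose A := [set y : 'rV[R]_1 | W (e * (y 0 0 - k))].
pose B := [set y : 'rV[R]_1 | y 0 0 < b - a].
have cc : continuous (fun y : 'rV[R]_1 => y 0 0) by move=> y; exact: coord_continuous.
exists (A `&` B).
  apply: openI; last first.
    apply: (@open_comp _ _ (fun y : 'rV[R]_1 => y 0 0) [set x | x < b - a]).
      by move=> y _; exact: cc.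
    exact: open_lt.
  apply: (@open_comp _ _ (fun y : 'rV[R]_1 => e * (y 0 0 - k)) W) => // y _.
  exact: cvgM (cvg_cst (e : R^o)) (cvgB (cc y) (cvg_cst (k : R^o))).
have eK x : e * (e * x + k - k) = x by rewrite addrK mulrA e2 mul1r.
apply/seteqP; split => [_ [s Ws <-]|y [[Wy yb] y0]].
  split; last first.
    by move=> i; rewrite mxE; have := itv_bounds s; rewrite ekP => /andP[].
  by split; rewrite /A /B /= mxE ?eK//; exact: Vdom.
have yab : a <= e * (y 0 0 - k) <= b.
  by rewrite ekP mulrA e2 mul1r subrK y0 ltW.
exists (itv_point yab) => //; apply/matrixP => i j.
by rewrite mxE !ord1 /= mulrA e2 mul1r subrK.
Qed.

Definition affine_chart : chart R itv_space :=
  Chart affine_dom_open affine_inj (fun s _ => @affine_continuous s) affine_open.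

End affine_chart.

Lemma left_chart_range s : (a <= s <= b) = (0 <= 1 * s + - a <= b - a).
Proof. by rewrite mul1r subr_ge0 lerD2r. Qed.

Lemma right_chart_range s : (a <= s <= b) = (0 <= -1 * s + b <= b - a).
Proof. by apply/idP/idP => /andP[? ?]; apply/andP; split; lra. Qed.

Let N1N1 : -1 * -1 = 1 :> R. Proof. by rewrite mulrNN mulr1. Qed.

Definition left_chart := affine_chart (mulr1 1) left_chart_range.
Definition right_chart := affine_chart N1N1 right_chart_range.


Definition point_dom : set itv_space := [set _ | a = b].

Lemma point_dom_open : open point_dom.
Proof.
have [ab|ab] := pselect (a = b).
  by rewrite (_ : point_dom = setT) ?predeqE//; exact: openT.
by rewrite (_ : point_dom = set0) ?predeqE//; exact: open0.
Qed.

Lemma point_inj : set_inj point_dom (fun=> 0 : 'rV[R]_0).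
Proof.
move=> s t /set_mem ab t_dom st; apply: itv_val_inj; move: ab; rewrite /point_dom /= => ab.
by have := itv_bounds t; have := itv_bounds s; rewrite ab => /le_anti -> /le_anti ->.
Qed.

Lemma point_continuous s : point_dom s ->
  {for s, continuous (fun=> 0 : 'rV[R]_0)}.
Proof. by move=> _; exact: (@cst_continuous _ _ (0 : 'rV[R]_0) s). Qed.

Lemma point_open V : open V -> V `<=` point_dom ->
  exists2 O, open O & (fun=> 0 : 'rV[R]_0) @` V = O `&` @corner R 0.
Proof.
move=> oV _; have [[s Vs]|V0] := pselect (V !=set0).
  exists setT; first exact: openT.
  apply/seteqP; split => [y Vy|y y0]; first by split => // -[].
  by exists s => //; apply/matrixP => i [].
exists set0; first exact: open0.
by rewrite set0I; apply/seteqP; split => // y [s Vs sy]; apply: V0; exists s.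
Qed.

Definition point_chart : chart R itv_space :=
  Chart point_dom_open point_inj point_continuous point_open.

Lemma affine_compatible e k e' k' (e2 : e * e = 1) (e2' : e' * e' = 1) ekP ekP' :
  chart_compatible (@affine_chart e k e2 ekP) (@affine_chart e' k' e2' ekP').
Proof.
move=> j p _; exists setT, (fun y => (e' * e) * y 0 0 + cst (k' - e' * e * k) y).
split => //; first exact: openT.
  apply: smooth_on_lin; [exact: openT|exact: smooth_on_coord|exact: smooth_on_cst].
move=> q _ _; rewrite /= !mxE.
rewrite [RHS](_ : _ = (e * e) * (e' * itv_val q) + k'); last by ring.
by rewrite e2 mul1r.
Qed.

Lemma affine_dom_lt e k (ekP : forall s, (a <= s <= b) = (0 <= e * s + k <= b - a)) s :
  affine_dom e k s -> a < b.
Proof.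
move=> sab; have := itv_bounds s; rewrite ekP => /andP[s0 _].
by rewrite -subr_gt0; exact: le_lt_trans sab.
Qed.

Definition itv_atlas : set (chart R itv_space) :=
  [set left_chart; right_chart; point_chart].

Lemma itv_cover p : exists2 c, itv_atlas c & chart_dom c p.
Proof.
have := itv_bounds p => /andP[ap pb].
have [pb'|bp] := ltP (itv_val p) b.
  by exists left_chart; [left; left|rewrite /= /affine_dom /= mul1r ltrD2r].
have [ap'|pa] := ltP a (itv_val p).
  exists right_chart; first by left; right.
  by rewrite /= /affine_dom /=; lra.
exists point_chart; first by right.
by rewrite /= /point_dom /=; apply/le_anti; rewrite (le_trans ap pb) (le_trans bp pa).
Qed.

Lemma itv_compatible c d : itv_atlas c -> itv_atlas d -> chart_compatible c d.
Proof.
have lt_dom e k (ekP : forall s, (a <= s <= b) = (0 <= e * s + k <= b - a)) p :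
    @affine_dom e k p -> point_dom p -> False.
  by move=> /(affine_dom_lt ekP) + ab; rewrite (ab : a = b) ltxx.
move=> [[->|->]|->] [[->|->]|->]; try exact: affine_compatible;
  try (by move=> -[]);
  move=> j p [p1 p2]; exfalso;
  first [exact: (lt_dom _ _ left_chart_range _ p1 p2)
        |exact: (lt_dom _ _ right_chart_range _ p1 p2)
        |exact: (lt_dom _ _ left_chart_range _ p2 p1)
        |exact: (lt_dom _ _ right_chart_range _ p2 p1)].
Qed.

Definition itv_region : region R :=
  Region itv_hausdorff itv_second_countable itv_cover itv_compatible.

End interval_region.

Section difference_quotient.
Context (R : realType) (T : topologicalType) (v : T -> R) (p : T).
Hypotheses (vc : continuous v) (vi : injective v).

Definition diff_quot (f : T -> R) (q : T) : R := (f q - f p) / (v q - v p).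

Lemma diff_quot_chart (e k : R) (U : set T) (O : set 'rV[R]_1) g (f : T -> R) :
  e * e = 1 -> open U -> U p -> open O -> O (const_mx (e * v p + k)) ->
  smooth_on O g ->
  (forall q, U q -> O (const_mx (e * v q + k)) -> f q = g (const_mx (e * v q + k))) ->
  diff_quot f @ p^' --> e * 'D_(const_mx 1) g (const_mx (e * v p + k)).
Proof.
move=> e2 oU Up oO Op sg fg.
pose x : 'rV[R]_1 := const_mx (e * v p + k); pose u : 'rV[R]_1 := const_mx 1.
pose h q := e * (v q - v p).
have hE q : const_mx (e * v q + k) = h q *: u + x.
  by apply/matrixP => i j; rewrite !mxE /h; ring.
have hc : h @ p^' --> 0^'.
  move=> A /= A0; rewrite /nbhs /= /within /= in A0 *.
  have hp : h q @[q --> p] --> (0 : R).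
    have -> : 0 = e * v p + - (e * v p) by ring.
    rewrite (_ : h = fun q => e * v q + - (e * v p)); last first.
      by apply/funext => q; rewrite /h; ring.
    exact: (@continuous_affine _ _ v e (- (e * v p)) vc p).
  have hA : nbhs p [set q | h q != 0 -> A (h q)] := hp _ A0.
  apply: filterS hA => q Aq qp; apply: Aq.
  rewrite /h mulf_neq0//; last by rewrite subr_eq0; apply: contra qp => /eqP/vi ->.
  by apply: contra_eq_neq e2 => ->; rewrite mul0r eq_sym oner_neq0.
have [_ /(_ u) dg] := sg [::] x Op.
have D : (fun r : R => r^-1 *: ((g \o shift x) (r *: u) - g x)) @ 0^' --> 'D_u g x.
  exact: dg.
have De : (h q)^-1 * (g (h q *: u + x) - g x) @[q --> p^'] --> 'D_u g x.
  by move=> A /D; exact: hc.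
have : (fun q => e * (h q)^-1 * (g (h q *: u + x) - g x)) @ p^' --> e * 'D_u g x.
  rewrite (_ : (fun q => _) =
      fun q => e * ((h q)^-1 * (g (h q *: u + x) - g x))); last first.
    by apply/funext => q; rewrite mulrA.
  exact: cvgMl_tmp.
apply: cvg_trans; apply: near_eq_cvg; near=> q.
have Uq : U q by near: q; apply: nbhs_dnbhs; exact: open_nbhs_nbhs.
have Oq : O (const_mx (e * v q + k)).
  near: q; apply: nbhs_dnbhs.
  have cx : {for p, continuous (fun q => const_mx (e * v q + k) : 'rV[R]_1)}.
    exact: continuous_const_mx (continuous_affine vc) _.
  by apply: cx; exact: open_nbhs_nbhs.
rewrite /diff_quot (fg q)// (fg p)// -hE mulrC; congr (_ * _).
by rewrite /h invfM mulrA divff ?mul1r//;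
  apply: contra_eq_neq e2 => ->; rewrite mul0r eq_sym oner_neq0.
Unshelve. all: by end_near. Qed.

Lemma diff_quot_lin (c : R) (f g : T -> R) (l m : R) : ProperFilter p^' ->
  diff_quot f @ p^' --> l -> diff_quot g @ p^' --> m ->
  diff_quot (fun q => c * f q + g q) @ p^' --> c * l + m.
Proof.
move=> pp fl gm.
have -> : diff_quot (fun q => c * f q + g q) =
    fun q => c * diff_quot f q + diff_quot g q.
  by apply/funext => q; rewrite /diff_quot; ring.
by apply: cvgD => //; exact: cvgMl_tmp.
Qed.

Lemma diff_quot_mul (f g : T -> R) (l m : R) : ProperFilter p^' ->
  diff_quot f @ p^' --> l -> diff_quot g @ p^' --> m ->
  diff_quot (fun q => f q * g q) @ p^' --> f p * m + l * g p.
Proof.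
move=> pp fl gm.
have -> : diff_quot (fun q => f q * g q) = fun q =>
    f p * diff_quot g q + diff_quot f q * g p +
    diff_quot f q * diff_quot g q * (v q - v p).
  apply/funext => q; rewrite /diff_quot.
  have [->|qp] := eqVneq q p; first by rewrite !subrr; ring.
  have vqp : v q - v p != 0.
    by rewrite subr_eq0; apply: contra qp => /eqP/vi ->.
  by field.
rewrite -[X in _ --> X]addr0 -[X in _ + X](mulr0 (l * m)).
have v0 : v q - v p @[q --> p^'] --> (0 : R).
  have v0 : v q - v p @[q --> p] --> (0 : R).
    by rewrite -(subrr (v p)); apply: cvgB; [exact: vc|exact: cvg_cst].
  by move=> A /v0; exact: nbhs_dnbhs.
apply: cvgD; last by apply: cvgM => //; exact: cvgM.
by apply: cvgD; [exact: cvgMl_tmp|exact: cvgMr_tmp].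
Qed.

End difference_quotient.

Section time_derivative.
Context (R : realType) (a b : R).
Local Notation I := (itv_region a b).
Local Notation t := (@itv_val R a b).

Lemma itv_dnbhs_proper (p : I) : a < b -> ProperFilter p^'.
Proof.
move=> ab; apply: Build_ProperFilter_ex => A [_ [[W oW <-] Wp WA]].
have /nbhs_ballP[e /= e0 eW] : nbhs (t p) W by exact: open_nbhs_nbhs.
suff [s [sab sp se]] : exists s, [/\ a <= s <= b, s != t p & `|t p - s| < e].
  exists (itv_point sab); apply: WA; first by apply: eW.
  by apply: contra sp => /eqP <-.
have /andP[ap pb] := itv_bounds p; have e20 : 0 < e / 2 by rewrite divr_gt0.
have [pb'|bp] := ltP (t p) b.
  have m1 : Num.min b (t p + e / 2) <= b by rewrite ge_min lexx.
  have m2 : Num.min b (t p + e / 2) <= t p + e / 2 by rewrite ge_min lexx orbT.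
  have m3 : t p < Num.min b (t p + e / 2) by rewrite lt_min pb' ltrDl.
  move: (Num.min _ _) m1 m2 m3 => s m1 m2 m3; exists s; split.
  - by apply/andP; split; lra.
  - by rewrite gt_eqF.
  - by rewrite ltr_distlC; apply/andP; split; lra.
have m1 : a <= Num.max a (t p - e / 2) by rewrite le_max lexx.
have m2 : t p - e / 2 <= Num.max a (t p - e / 2) by rewrite le_max lexx orbT.
have m3 : Num.max a (t p - e / 2) < t p by rewrite gt_max; apply/andP; split; lra.
move: (Num.max _ _) m1 m2 m3 => s m1 m2 m3; exists s; split.
- by apply/andP; split; lra.
- by rewrite lt_eqF.
- by rewrite ltr_distlC; apply/andP; split; lra.
Qed.

(* The derivative at p of a smooth function on [a, b], one-sided at the end
   points. The tangent space of a one-point interval is zero. *)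
Definition time_derivative (p : I) (f : smooth_fun I) : R :=
  if a < b then lim (diff_quot t p f @ p^') else 0.

Lemma diff_quot_affine_chart e k e2 ekP (f : I -> R) :
  let c : chart R I := @affine_chart R a b e k e2 ekP in
  smooth_in_chart c (chart_dom c) f -> forall p, chart_dom c p ->
  exists (O : set 'rV[R]_1) g, [/\ open O, O (c p), smooth_on O g &
    forall q, chart_dom c q -> O (c q) ->
      diff_quot t q f @ q^' --> e * 'D_(const_mx 1) g (c q)].
Proof.
move=> c sf p cp; have [U [g [oU Up sg fg]]] := sf p cp.
exists U, g; split => // q cq Uq.
exact: (diff_quot_chart (@itv_val_continuous R a b) (@itv_val_inj R a b)
  e2 (chart_dom_open c) cq oU Uq sg fg).
Qed.

Lemma is_cvg_diff_quot (f : smooth_fun I) (p : I) : a < b ->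
  cvg (diff_quot t p f @ p^').
Proof.
move=> ab; apply/cvg_ex.
have [c Ac cp] := region_cover p.
have sf := smooth_funP f Ac.
case: Ac sf cp => [[->|->]|->] sf cp.
- by have [U [g [_ Up _ h]]] := diff_quot_affine_chart sf cp; eexists; exact: h cp Up.
- by have [U [g [_ Up _ h]]] := diff_quot_affine_chart sf cp; eexists; exact: h cp Up.
- by have /eqP := (cp : a = b); rewrite (lt_eqF ab).
Qed.

Lemma time_derivative_linear (p : I) c (f g : smooth_fun I) :
  time_derivative p (smooth_fun_lin c f g) =
  c * time_derivative p f + time_derivative p g.
Proof.
rewrite /time_derivative; case: ifPn => [ab|_]; last by rewrite mulr0 addr0.
have pp := itv_dnbhs_proper p ab.
apply: cvg_lim => //; apply: diff_quot_lin; exact: is_cvg_diff_quot.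
Qed.

Lemma time_derivative_leibniz (p : I) (f g : smooth_fun I) :
  time_derivative p (smooth_fun_mul f g) =
  f p * time_derivative p g + time_derivative p f * g p.
Proof.
rewrite /time_derivative; case: ifPn => [ab|_]; last by rewrite mulr0 mul0r addr0.
have pp := itv_dnbhs_proper p ab.
apply: cvg_lim => //; apply: diff_quot_mul; try exact: is_cvg_diff_quot.
- exact: itv_val_continuous.
- exact: itv_val_inj.
Qed.

Lemma time_derivative_smooth (f : smooth_fun I) :
  is_smooth_fun (fun p : I => time_derivative p f).
Proof.
have aff e k e2 ekP (c := @affine_chart R a b e k e2 ekP : chart R I) :
    region_atlas c -> smooth_in_chart c (chart_dom c) (fun p => time_derivative p f).
  move=> Ac p cp; have ab := affine_dom_lt ekP cp.
  have [U [g [oU Up sg h]]] := diff_quot_affine_chart (smooth_funP f Ac) cp.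
  exists U, (fun x => e * 'D_(const_mx 1) g x + cst 0 x); split => //.
    apply: smooth_on_lin => //; first exact: smooth_on_derive.
    exact: smooth_on_cst.
  move=> q cq Uq; rewrite /= addr0 /time_derivative ab.
  have pp := itv_dnbhs_proper q ab.
  by apply: cvg_lim => //; exact: h.
move=> c Ac; have sf := smooth_funP f Ac.
case: (Ac) => [[cE|cE]|cE]; rewrite cE in Ac *.
- exact: aff.
- exact: aff.
- move=> p pp; exists setT, (cst 0); split => //; first exact: openT.
    exact: smooth_on_cst.
  move=> q /(introT eqP) ab _; rewrite /time_derivative.
  by case: ifPn => // /lt_eqF; rewrite ab.
Qed.

Definition ddt : vector_field I :=
  @VectorField R I
    (fun p => Tangent (time_derivative_linear p) (time_derivative_leibniz p))
    time_derivative_smooth.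

End time_derivative.

(* A directed multigraph. Its arrows are given as a family indexed by their
   source and target; the collection of all arrows is the sum of this family.
   Nodes and arrows may form a large collection, as they do in RR. *)
Record graph := Graph { node :> Type; arrow : node -> node -> Type }.

Record graph_map (A B : graph) := GraphMap {
  on_node :> A -> B;
  on_arrow : forall a1 a2 : A, arrow a1 a2 -> arrow (on_node a1) (on_node a2) }.

Definition graph_map_comp (A B C : graph) (g : graph_map B C)
    (f : graph_map A B) : graph_map A C :=
  @GraphMap A C (g \o f) (fun _ _ c => on_arrow g (on_arrow f c)).

Inductive dipath (Z : graph) : Z -> Z -> Type :=
| dipath_nil x : dipath x x
| dipath_cons x y z of arrow x y & dipath y z : dipath x z.

(* The arrows from P to Q are the relations from P to Q, which are subsets of
   Q * P in this order. *)
Definition RR (R : realType) : graph :=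
  @Graph (region R) (fun P Q => set (Q * P)).

Definition hybrid_phase_space (R : realType) (A : graph) := graph_map A (RR R).

(* A pair (phi, alpha) without the condition on relations, which is stated in
   is_phase_map. *)
Record phase_pair (R : realType) (A B : graph) (P : hybrid_phase_space R A)
    (Q : hybrid_phase_space R B) := PhasePair {
  pair_graph : graph_map A B;
  pair_smooth : forall a : A, @smooth_map R (P a) (Q (pair_graph a)) }.

Definition is_phase_map (R : realType) (A B : graph)
    (P : hybrid_phase_space R A) (Q : hybrid_phase_space R B)
    (m : phase_pair P Q) :=
  forall (a1 a2 : A) (c : arrow a1 a2),
    [set (pair_smooth m a2 yx.1, pair_smooth m a1 yx.2) | yx in on_arrow P c]
      `<=` on_arrow Q (on_arrow (pair_graph m) c).

Definition phase_pair_comp (R : realType) (A B C : graph)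
    (P : hybrid_phase_space R A) (Q : hybrid_phase_space R B)
    (S : hybrid_phase_space R C) (n : phase_pair Q S) (m : phase_pair P Q) :
    phase_pair P S :=
  @PhasePair R A C P S (graph_map_comp (pair_graph n) (pair_graph m))
    (fun a => smooth_map_comp (pair_smooth n (pair_graph m a)) (pair_smooth m a)).

Record hds (R : realType) := Hds {
  hds_graph : graph;
  hds_phase :> hybrid_phase_space R hds_graph;
  hds_field : forall a : hds_graph, @vector_field R (hds_phase a) }.

Arguments hds_field {R} h a.

Definition related_at (R : realType) (H K : hds R) (m : phase_pair H K)
    (a : hds_graph H) :=
  forall x : hds_phase H a,
    hds_field K (pair_graph m a) (pair_smooth m a x) =
    differential (pair_smooth m a) (hds_field H a x).

Definition is_hds_map (R : realType) (H K : hds R) (m : phase_pair H K) :=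
  is_phase_map m /\ forall a, related_at m a.

(* The data of a hybrid time dynamical system; the system itself is time_hds. *)
Record hybrid_time (R : realType) := HybridTime {
  time_graph : graph;
  time_countable : exists code : time_graph -> nat, injective code;
  time_linear : forall x y : time_graph, x <> y ->
    ((exists! c : dipath x y, True) /\ (dipath y x -> False)) \/
    ((exists! c : dipath y x, True) /\ (dipath x y -> False));
  time_start : time_graph -> R;
  time_end : time_graph -> R;
  time_le : forall i, time_start i <= time_end i;
  time_jump : forall i j : time_graph, arrow i j -> time_end i = time_start j }.

Definition itv_start (R : realType) (a b : R) (ab : a <= b) : itv_region a b :=
  itv_point (introT andP (conj (lexx a) ab)).

Definition itv_end (R : realType) (a b : R) (ab : a <= b) : itv_region a b :=
  itv_point (introT andP (conj ab (lexx b))).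

Definition time_phase (R : realType) (T : hybrid_time R) :
    hybrid_phase_space R (time_graph T) :=
  @GraphMap (time_graph T) (RR R)
    (fun i => itv_region (time_start i) (time_end i))
    (fun i j _ => [set (itv_start (time_le j), itv_end (time_le i))]).

Definition time_hds (R : realType) (T : hybrid_time R) : hds R :=
  @Hds R (time_graph T) (time_phase T)
    (fun i => ddt (time_start i) (time_end i)).

(* On a one-point interval any map counts as an integral curve. *)
Definition is_execution (R : realType) (T : hybrid_time R) (H : hds R)
    (e : phase_pair (time_hds T) H) :=
  is_phase_map e /\
  forall i : time_graph T, time_start i < time_end i -> related_at e i.

(* Main.v *)
Require Import Defs.
From mathcomp Require Import all_boot all_order all_algebra.
From mathcomp Require Import all_classical all_reals all_analysis.

(** Both conditions on a map survive composition. Relation inclusions chain ([is_phase_map_comp]),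
    and by the chain rule [differential_comp], $Y\circ\alpha\circ\sigma = T\alpha\circ X\circ\sigma
    = T\alpha\circ T\sigma\circ\frac{d}{dt} = T(\alpha\circ\sigma)\circ\frac{d}{dt}$
    ([related_at_comp]). *)

Lemma tangent_eq (R : realType) (M : region R) (p : M) (v w : tangent p) :
  v =1 w -> v = w.
Proof.
case: v w => [v lv Lv] [w lw Lw] /= /funext vw.
by case: _ / vw in lw Lw *; congr Tangent; exact: Prop_irrelevance.
Qed.

(* Since tangent vectors are derivations, both sides evaluate f to v (f \o k \o h)
   definitionally; they differ only in their proofs of linearity and Leibniz. *)
Lemma differential_comp (R : realType) (M N P : region R)
    (k : smooth_map N P) (h : smooth_map M N) (p : M) (v : tangent p) :
  differential (smooth_map_comp k h) v = differential k (differential h v).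
Proof. exact: tangent_eq. Qed.

Lemma is_phase_map_comp (R : realType) (A B C : graph)
    (P : hybrid_phase_space R A) (Q : hybrid_phase_space R B)
    (S : hybrid_phase_space R C) (n : phase_pair Q S) (m : phase_pair P Q) :
  is_phase_map n -> is_phase_map m -> is_phase_map (phase_pair_comp n m).
Proof.
move=> nP mP a1 a2 c _ [yx Pyx <-]; apply: nP.
by exists (pair_smooth m a2 yx.1, pair_smooth m a1 yx.2) => //; apply: mP; exists yx.
Qed.

(** Kept to a single node, since an execution is related to $\frac{d}{dt}$ only at its nondegenerate
    intervals. *)
Lemma related_at_comp (R : realType) (H K L : hds R) (n : phase_pair K L)
    (m : phase_pair H K) (a : hds_graph H) :
  related_at n (pair_graph m a) -> related_at m a ->
  related_at (phase_pair_comp n m) a.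
Proof.
by move=> rn rm x; rewrite [RHS]differential_comp -rm; exact: rn.
Qed.

Theorem theorem4p9 (R : realType) (H K : hds R) (m : phase_pair H K)
    (T : hybrid_time R) (e : phase_pair (time_hds T) H) :
  is_hds_map m -> is_execution e -> is_execution (phase_pair_comp m e).
Proof.
move=> [mP mr] [eP er]; split; first exact: is_phase_map_comp.
(* [mr] holds at every node, so also at the image of [i]; [lt_i] is what [er] asks for. *)
by move=> i lt_i; apply: related_at_comp (mr _) (er i lt_i).
Qed.
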